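(* Let $H$ be an $m\times m$ real symmetric positive definite matrix with condition number $\kappa$, let $H=U\Lambda U^T$ be its spectral decomposition with orthogonal $U=[u_1,\dots,u_m]$, $\Lambda=\mathrm{diag}(\lambda_1,\dots,\lambda_m)$ and $0<\lambda_1\le\lambda_2\le\cdots\le\lambda_m$, and let $F_1$, the orbits $O^+(r_0,H)$ and $O^+(y_0,\Lambda)$, and the $ij$-critical lines be as defined in the context. Then the following hold. (i) $F_1$ is homogeneous of degree one: for any scalar $\alpha\in\mathbb{R}$ and $r\in\mathbb{R}^m$, $F_1(\alpha r)=\alpha F_1(r)$. In particular, for any nonzero $r_0\in\mathbb{R}^m$, the orbit at $r_0$ is $\|r_0\|$ times the orbit at $r_0/\|r_0\|$. Consequently the dynamics of $F_1$ on the unit ball is identical (up to scaling) with its dynamics on a ball of arbitrary positive radius centered at the origin. (ii) Given $r_0\in\mathbb{R}^m$ and $y_0=U^Tr_0$, let $(r_k)$ and $(y_k)$ be the orbits $O^+(r_0,H)$ and $O^+(y_0,\Lambda)$. Then for all $k$, $\|r_k\|=\|y_k\|$, and if $r_k\neq 0$, $$\frac{\|r_{k+1}\|^2}{\|r_k\|^2}=1-\frac{(r_k^THr_k)^2}{r_k^TH^2r_k}\,\frac{1}{\|r_k\|^2}=\frac{\|y_{k+1}\|^2}{\|y_k\|^2}=1-\frac{(y_k^T\Lambda y_k)^2}{y_k^T\Lambda^2y_k}\,\frac{1}{\|y_k\|^2}.$$ In particular, $O^+(r_0,H)$ and $O^+(y_0,\Lambda)$ both converge to zero with the same convergence rate.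 (iii) If $r_0\neq 0$ is an eigenvector of $H$, then $r_1=F_1(r_0)=0$, so the orbit converges in one step. Moreover, suppose $r_0$ is an $\varepsilon$-approximate unit eigenvector, i.e. for a scalar $\lambda>0$ and a vector $e\in\mathbb{R}^m$, $$Hr_0=\lambda r_0+e,\qquad \|r_0\|=1,\qquad \|e\|\le\varepsilon .$$ If $\varepsilon\le\lambda^2/(4\kappa)$, then $r_1=F_1(r_0)$ satisfies $$\|r_1\|\le 2\sqrt{\frac{\kappa\varepsilon}{\lambda}}.$$ (iv) For any $m\ge 2$ there are at most $m(m-1)$ distinct critical lines. Let $i,j$ be indices with $\lambda_i<\lambda_j$ and set $$\kappa_{ij}=\frac{\lambda_j}{\lambda_i},\qquad \rho_{ij}=\frac{\lambda_j-\lambda_i}{\lambda_j+\lambda_i}=\frac{\kappa_{ij}-1}{\kappa_{ij}+1}.$$ Then, for every $\alpha\in\mathbb{R}$, $$F_1(\alpha r^{+})=\alpha\rho_{ij}\,r^{-},\qquad F_1(\alpha r^{-})=\alpha\rho_{ij}\,r^{+}.$$ Thus the orbit of a point on the $ij$-critical lines zig-zags between the two lines, and if $r_0$ lies on an $ij$-critical line, then for all $k$ the $k$-th residual satisfies $$\|r_k\|=\rho_{ij}^k\,\|r_0\|.$$ In particular, if $r_0$ is on a $1m$-critical line (i.e. $i=1$, $j=m$, with $\lambda_1<\lambda_m$), the worst-case complexity of $F_1$ is attained, in that for all $k$ $$\|r_k\|=\rho_{1m}^k\|r_0\|=\left(\frac{\kappa-1}{\kappa+1}\right)^k\|r_0\|.$$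 However, if $r_k$ is on an $ij$-critical line and $r_{k+1}=F_1(r_k)$, then the convex combination $\overline r_k=\alpha_*r_k+(1-\alpha_* )r_{k+1}$ with $\alpha_*=\rho_{ij}/(\rho_{ij}+1)$ satisfies $F_1(\overline r_k)=0$.
   Context: $\|\cdot\|$ is the Euclidean norm. In the application $H=AA^T$ for an $m\times n$ real matrix $A$, or $H=A$ when $A$ is symmetric positive semidefinite; here only that $H$ is symmetric positive definite is used. The condition number is $\kappa=\lambda_m/\lambda_1$. The first-order Centering Triangle Algorithm map $F_1:\mathbb{R}^m\to\mathbb{R}^m$ is $$F_1(r)=r-\frac{r^THr}{r^TH^2r}\,Hr\quad(r\neq 0),\qquad F_1(0)=0 .$$ For $r_0\in\mathbb{R}^m$, the residual orbit $O^+(r_0,H)$ is the sequence $r_k=F_1(r_{k-1})$, $k=1,2,\dots$. For $y_0\in\mathbb{R}^m$, the orbit $O^+(y_0,\Lambda)$ is the sequence defined by the same recursion with $\Lambda$ in place of $H$, i.e. $$y_{k+1}=y_k-\frac{y_k^T\Lambda y_k}{y_k^T\Lambda^2y_k}\,\Lambda y_k\quad(y_k\ne 0),\qquad y_{k+1}=0\ \text{ if } y_k=0 .$$ The vectors $u_1,\dots,u_m$ are the fixed orthonormal eigenvectors forming the columns of $U$, with $Hu_i=\lambda_iu_i$. For each pair $i,j$ with $\lambda_i<\lambda_j$ put $$\alpha_i=\sqrt{\frac{\lambda_j}{\lambda_i+\lambda_j}},\qquad \alpha_j=\sqrt{\frac{\lambda_i}{\lambda_i+\lambda_j}},\qquad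 r^{+}=\alpha_iu_i+\alpha_ju_j,\qquad r^{-}=\alpha_iu_i-\alpha_ju_j .$$ (The vectors $r^\pm$ depend on the pair $i,j$.) The $ij$-critical lines are the pair of lines $l_{ij}^+=\{\alpha r^+:\alpha\in\mathbb{R}\}$ and $l_{ij}^-=\{\alpha r^-:\alpha\in\mathbb{R}\}$; the critical lines of $H$ are all such lines over all pairs with $\lambda_i<\lambda_j$. *)

(* Defs.v *)
From HB Require Import structures.
From mathcomp Require Import all_boot all_order all_algebra.
From mathcomp Require Import all_classical all_reals all_analysis.

Set Implicit Arguments.
Unset Strict Implicit.
Unset Printing Implicit Defensive.

Import Order.TTheory GRing.Theory Num.Theory.
Import numFieldNormedType.Exports.

Local Open Scope classical_set_scope.
Local Open Scope ring_scope.

Section Defs.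
Context {R : realType}.

Definition qform {m : nat} (M : 'M[R]_m) (x : 'cV[R]_m) : R :=
  (x^T *m M *m x) 0 0.

(* The library norm `|x| on matrices is the max norm, hence this one. *)
Definition enorm {m : nat} (x : 'cV[R]_m) : R :=
  Num.sqrt (\sum_(i < m) x i 0 ^+ 2).

Definition eball {m : nat} (rho : R) : set 'cV[R]_m :=
  [set x | enorm x <= rho].

Definition symposdef {m : nat} (H : 'M[R]_m) : Prop :=
  H^T = H /\ forall x : 'cV[R]_m, x != 0 -> 0 < qform H x.

Definition orthogonalmx {m : nat} (U : 'M[R]_m) : Prop :=
  U^T *m U = 1%:M /\ U *m U^T = 1%:M.

(* The eigenvectors u_i are the columns col i U. *)
Definition spectral_decomposition {m : nat}
    (H U : 'M[R]_m) (lam : 'rV[R]_m) : Prop :=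
  [/\ orthogonalmx U,
      H = U *m diag_mx lam *m U^T,
      forall i, 0 < lam 0 i
    & forall i j : 'I_m, (i <= j)%N -> lam 0 i <= lam 0 j].

Definition cond_num {n : nat} (lam : 'rV[R]_n.+1) : R :=
  lam 0 ord_max / lam 0 ord0.

Definition F1 {m : nat} (H : 'M[R]_m) (r : 'cV[R]_m) : 'cV[R]_m :=
  if r == 0 then 0 else r - (qform H r / qform (H *m H) r) *: (H *m r).

Definition F1_orbit {m : nat} (H : 'M[R]_m) (r0 : 'cV[R]_m) (k : nat) :
    'cV[R]_m :=
  iter k (F1 H) r0.

(* Asymptotic quotient rate limsup_k |x_{k+1}| / |x_k|.  Since 0 / 0 = 0, it
   is 0 for a sequence that is eventually zero. *)
Definition conv_rate {m : nat} (x : nat -> 'cV[R]_m) : \bar R :=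
  limn_esup (fun k => (enorm (x k.+1) / enorm (x k))%:E).

Definition rplus {m : nat} (U : 'M[R]_m) (lam : 'rV[R]_m) (i j : 'I_m) :
    'cV[R]_m :=
  Num.sqrt (lam 0 j / (lam 0 i + lam 0 j)) *: col i U
  + Num.sqrt (lam 0 i / (lam 0 i + lam 0 j)) *: col j U.

Definition rminus {m : nat} (U : 'M[R]_m) (lam : 'rV[R]_m) (i j : 'I_m) :
    'cV[R]_m :=
  Num.sqrt (lam 0 j / (lam 0 i + lam 0 j)) *: col i U
  - Num.sqrt (lam 0 i / (lam 0 i + lam 0 j)) *: col j U.

Definition line {m : nat} (v : 'cV[R]_m) : set 'cV[R]_m :=
  [set a *: v | a in [set: R]].

Definition lplus {m : nat} (U : 'M[R]_m) (lam : 'rV[R]_m) (i j : 'I_m) :=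
  line (rplus U lam i j).

Definition lminus {m : nat} (U : 'M[R]_m) (lam : 'rV[R]_m) (i j : 'I_m) :=
  line (rminus U lam i j).

Definition critical_lines {m : nat} (U : 'M[R]_m) (lam : 'rV[R]_m) :
    set (set 'cV[R]_m) :=
  [set L | exists i j : 'I_m, lam 0 i < lam 0 j /\
             (L = lplus U lam i j \/ L = lminus U lam i j)].

Definition kappa_ij {m : nat} (lam : 'rV[R]_m) (i j : 'I_m) : R :=
  lam 0 j / lam 0 i.

Definition rho_ij {m : nat} (lam : 'rV[R]_m) (i j : 'I_m) : R :=
  (lam 0 j - lam 0 i) / (lam 0 j + lam 0 i).

End Defs.

(* Main.v *)
Require Import Defs.
From HB Require Import structures.
From mathcomp Require Import all_boot all_order all_algebra.
From mathcomp Require Import all_classical all_reals all_analysis.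
From mathcomp Require Import ring lra.

Set Implicit Arguments.
Unset Strict Implicit.
Unset Printing Implicit Defensive.

Import Order.TTheory GRing.Theory Num.Theory.
Import numFieldNormedType.Exports.

Local Open Scope classical_set_scope.
Local Open Scope card_scope.
Local Open Scope ring_scope.

(* The step length of [F1] minimizes [|r - t H r|] over [t].  Comparing with
   [t = 2 / (lambda_1 + lambda_m)], for which every eigenvalue of [1 - t H] has
   modulus at most [rho = (kappa - 1) / (kappa + 1)], gives
   [|F1 r| <= rho |r|]: this is the worst-case bound, and it forces convergence
   to 0.  The change of variables [y = U^T r] intertwines [F1 H] and
   [F1 Lambda].  For an approximate unit eigenvector, with [a] the inner product
   of [r] and [e],
   [|F1 r|^2 = (|e|^2 - a^2) / (lambda^2 + 2 lambda a + |e|^2)].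
   On a critical line the step length is [2 / (lambda_i + lambda_j)], which
   multiplies the two coordinates by [rho_ij] and [- rho_ij]. *)

(** * Euclidean inner product and norm on column vectors *)

Section InnerProduct.
Context {R : realType} {m : nat}.
Implicit Types (x y z : 'cV[R]_m) (M H : 'M[R]_m) (a : R).

Definition dot x y : R := (x^T *m y) 0 0.

Lemma dotE x y : dot x y = \sum_i x i 0 * y i 0.
Proof. by rewrite /dot mxE; apply: eq_bigr => i _; rewrite mxE. Qed.

Lemma dotC x y : dot x y = dot y x.
Proof. by rewrite !dotE; apply: eq_bigr => i _; rewrite mulrC. Qed.

Lemma dotDr x y z : dot x (y + z) = dot x y + dot x z.
Proof. by rewrite /dot mulmxDr mxE. Qed.

Lemma dotZr a x y : dot x (a *: y) = a * dot x y.
Proof. by rewrite /dot -scalemxAr mxE. Qed.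

Lemma dotDl x y z : dot (x + y) z = dot x z + dot y z.
Proof. by rewrite dotC dotDr !(dotC z). Qed.

Lemma dotZl a x y : dot (a *: x) y = a * dot x y.
Proof. by rewrite dotC dotZr dotC. Qed.

Lemma dotNr x y : dot x (- y) = - dot x y.
Proof. by rewrite -scaleN1r dotZr mulN1r. Qed.

Lemma dotNl x y : dot (- x) y = - dot x y.
Proof. by rewrite dotC dotNr dotC. Qed.

Definition dot_lin := (dotDr, dotDl, dotNr, dotNl, dotZr, dotZl).

Lemma dot_ge0 x : 0 <= dot x x.
Proof. by rewrite dotE sumr_ge0// => i _; rewrite -expr2 sqr_ge0. Qed.

Lemma dot_eq0 x : (dot x x == 0) = (x == 0).
Proof.
apply/idP/eqP => [|->]; last by rewrite /dot mulmx0 mxE.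
rewrite dotE psumr_eq0 => [/allP x0|i _]; last by rewrite -expr2 sqr_ge0.
apply/colP => i; have := x0 i; rewrite mem_index_enum mxE => /(_ isT)/=.
by rewrite mulf_eq0 orbb => /eqP.
Qed.

Lemma dot_gt0 x : x != 0 -> 0 < dot x x.
Proof. by move=> x0; rewrite lt_def dot_ge0 dot_eq0 x0. Qed.

Lemma enormE x : enorm x = Num.sqrt (dot x x).
Proof.
by rewrite /enorm dotE; congr Num.sqrt; apply: eq_bigr => i _; rewrite expr2.
Qed.

Lemma enorm_ge0 x : 0 <= enorm x.
Proof. exact: sqrtr_ge0. Qed.

Lemma enorm_sqr x : enorm x ^+ 2 = dot x x.
Proof. by rewrite enormE sqr_sqrtr// dot_ge0. Qed.

Lemma enorm_eq0 x : (enorm x == 0) = (x == 0).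
Proof. by rewrite -sqrf_eq0 enorm_sqr dot_eq0. Qed.

Lemma enorm_le x a : 0 <= a -> dot x x <= a ^+ 2 -> enorm x <= a.
Proof. by move=> a0 h; rewrite -ler_sqr ?nnegrE ?enorm_ge0// enorm_sqr. Qed.

Lemma enormZ a x : enorm (a *: x) = `|a| * enorm x.
Proof. by rewrite !enormE dotZl dotZr mulrA -expr2 sqrtrM ?sqr_ge0// sqrtr_sqr. Qed.

Lemma qformE M x : qform M x = dot x (M *m x).
Proof. by rewrite /qform /dot mulmxA. Qed.

Lemma qform_sqr H x : H^T = H -> qform (H *m H) x = dot (H *m x) (H *m x).
Proof. by move=> HT; rewrite /qform /dot trmx_mul HT !mulmxA. Qed.

Lemma qformZ M a x : qform M (a *: x) = a ^+ 2 * qform M x.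
Proof. by rewrite !qformE -scalemxAr !dot_lin mulrA. Qed.

(** * Homogeneity of the map and of its orbits *)

Lemma F1_0 H : F1 H 0 = 0.
Proof. by rewrite /F1 eqxx. Qed.

(** At [x = 0] the formula also yields [0], whatever the quotient, because [H *m 0 = 0]; later
    rewriting thus avoids the case split. *)
Lemma F1E H x : F1 H x = x - (qform H x / qform (H *m H) x) *: (H *m x).
Proof. by rewrite /F1; case: eqVneq => // ->; rewrite mulmx0 scaler0 subr0. Qed.

Lemma F1Z H a x : F1 H (a *: x) = a *: F1 H x.
Proof.
have [->|a0] := eqVneq a 0; first by rewrite !scale0r F1_0.
rewrite !F1E !qformZ scalerBr -scalemxAr !scalerA; congr (_ - _ *: _).
(* [H] is arbitrary here, so [c] may vanish; then both quotients are [0] by the convention on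
   inverses. *)
set b := qform H x; set c := qform _ x; have [->|c0] := eqVneq c 0.
  by rewrite mulr0 invr0 !mulr0 mul0r.
by field; rewrite a0 c0.
Qed.

Lemma F1_orbitZ H a x k : F1_orbit H (a *: x) k = a *: F1_orbit H x k.
Proof. by elim: k => //= k ih; rewrite ih F1Z. Qed.

Lemma F1_orbit0 H k : F1_orbit H 0 k = 0.
Proof. by rewrite -(scale0r 0) F1_orbitZ !scale0r. Qed.

(** Together with [F1_orbitZ], this makes scaling by [a] a conjugacy between the dynamics on the two
    balls. *)
Lemma set_bij_eball a : 0 < a ->
  set_bij (eball 1) (eball a) (fun x : 'cV[R]_m => a *: x).
Proof.
move=> a0; split=> [x|x y _ _|x] /=.
- by rewrite /eball/= enormZ gtr0_norm// => x1; rewrite ler_piMr// ltW.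
- by apply: scalerI; exact: lt0r_neq0.
- rewrite /eball/= => xa; exists (a^-1 *: x).
    by rewrite /= enormZ gtr0_norm ?invr_gt0// mulrC ler_pdivrMr ?mul1r.
  by rewrite scalerA divff ?scale1r// lt0r_neq0.
Qed.

(** * One step for a positive definite matrix *)

Lemma symposdef_mul_neq0 H x : symposdef H -> x != 0 -> H *m x != 0.
Proof.
move=> [_ Hp] x0; apply/eqP => Hx0; have := Hp _ x0.
by rewrite qformE Hx0 /dot mulmx0 mxE ltxx.
Qed.

(** With [b = dot x (H *m x)] and [D = dot (H *m x) (H *m x)], expanding the square gives
    [- 2 b^2 / D + b^2 / D]. Symmetry identifies [D] with [qform (H *m H) x], and definiteness makes
    it nonzero. *)
Lemma dot_F1 H x : symposdef H -> x != 0 ->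
  dot (F1 H x) (F1 H x) = dot x x - qform H x ^+ 2 / qform (H *m H) x.
Proof.
move=> Hspd x0; rewrite F1E qform_sqr ?qformE; last by case: Hspd.
have := dot_gt0 (symposdef_mul_neq0 Hspd x0) => /lt0r_neq0.
rewrite !dot_lin (dotC (H *m x) x) => D0; field.
by rewrite D0.
Qed.

Lemma F1_ratio H x : symposdef H -> x != 0 ->
  enorm (F1 H x) ^+ 2 / enorm x ^+ 2 =
  1 - qform H x ^+ 2 / qform (H *m H) x * (1 / enorm x ^+ 2).
Proof.
move=> Hspd x0; rewrite !enorm_sqr dot_F1// mulrBl divff ?div1r//.
by rewrite dot_eq0.
Qed.

(* The step length minimizes [x - t H x] over t. *)
Lemma dot_F1_le H x t : symposdef H ->
  dot (F1 H x) (F1 H x) <= dot (x - t *: (H *m x)) (x - t *: (H *m x)).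
Proof.
move=> Hspd; have [->|x0] := eqVneq x 0.
  by rewrite F1_0 mulmx0 scaler0 subr0.
rewrite dot_F1// qform_sqr ?qformE; last by case: Hspd.
have D0 := dot_gt0 (symposdef_mul_neq0 Hspd x0).
rewrite -subr_ge0 !dot_lin (dotC (H *m x) x).
set b := dot x (H *m x); set D := dot _ (H *m x) in D0 *.
(* Completing the square in [t]; the minimum is at [t = b / D]. *)
rewrite (_ : _ - _ = (t * D - b) ^+ 2 / D); last first.
  by field; exact: lt0r_neq0.
by rewrite divr_ge0 ?sqr_ge0// ltW.
Qed.

(** Comparison with [t = 0]; it keeps centered balls invariant. *)
Lemma enorm_F1_le H x : symposdef H -> enorm (F1 H x) <= enorm x.
Proof.
move=> Hspd; apply: enorm_le; rewrite ?enorm_ge0// enorm_sqr.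
by have := dot_F1_le x 0 Hspd; rewrite scale0r subr0.
Qed.

(** This is the equality case of Cauchy-Schwarz for [x] and [H *m x], where the right side of
    [dot_F1] vanishes. *)
Lemma F1_eigenvector H x mu : symposdef H -> H *m x = mu *: x -> F1 H x = 0.
Proof.
move=> Hspd Hx; have [->|x0] := eqVneq x 0; first exact: F1_0.
apply/eqP; rewrite -dot_eq0 dot_F1// qform_sqr; last by case: Hspd.
have := symposdef_mul_neq0 Hspd x0; rewrite qformE Hx.
rewrite scaler_eq0 negb_or => /andP[mu0 _]; rewrite !dot_lin.
have /lt0r_neq0 := dot_gt0 x0 => D0; apply/eqP; field.
by rewrite D0 mu0.
Qed.

(** The scalar core of the estimate for approximate eigenvectors: [a] stands for the inner product
    of the unit vector with the error, [d] for the squared norm of the error, and [c] for the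
    condition number. *)
Lemma approx_eigenvector_bound (c l a d eps : R) : 1 <= c -> 0 < l ->
  0 <= eps -> a ^+ 2 <= d -> d <= eps ^+ 2 ->
  1 - (l + a) ^+ 2 / (l ^+ 2 + 2 * l * a + d) <= 4 * (c * eps / l).
Proof.
move=> c1 l0 e0 ad de; set D := _ + d.
have D_ge : (l + a) ^+ 2 <= D by rewrite /D; nra.
have D_ge0 : 0 <= D by apply: le_trans D_ge; exact: sqr_ge0.
have e_le_ce : eps <= c * eps by nra.
(* If [l <= 4 * eps], the right side is at least 1 and the left at most 1. Otherwise
   [|a| <= eps < l / 4], so the denominator is at least [(3 / 4 * l)^2]. *)
have [le1|lt1] := leP l (4 * eps).
  apply: (@le_trans _ _ 1).
    by rewrite gerBl divr_ge0// sqr_ge0.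
  by rewrite mulrA ler_pdivlMr// mul1r; lra.
have [a1 a2] : - eps <= a /\ a <= eps by split; nra.
have la : 3 / 4 * l <= l + a by lra.
have D9 : 9 / 16 * l ^+ 2 <= D by apply: le_trans D_ge; nra.
have D0 : 0 < D by apply: lt_le_trans D9; nra.
rewrite (_ : 1 - _ = (d - a ^+ 2) / D); last first.
  by rewrite /D; field; exact: lt0r_neq0.
(* The numerator is at most [eps^2 <= eps * l / 4], below the [9 / 4 * eps * l] available. *)
rewrite ler_pdivrMr// (@le_trans _ _ (4 * (eps / l) * (9 / 16 * l ^+ 2)))//.
  rewrite (_ : _ * (_ * _) = 9 / 4 * eps * l); last by field; exact: lt0r_neq0.
  nra.
have el : 0 <= eps / l by rewrite divr_ge0// ltW.
apply: ler_pM => //; first by rewrite mulr_ge0.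
  by rewrite mulr_ge0 ?sqr_ge0//; lra.
by rewrite ler_pM2l// ler_pM2r ?invr_gt0.
Qed.

Lemma enorm_F1_approx_eigenvector H x e c l eps : symposdef H -> 1 <= c ->
  0 < l -> H *m x = l *: x + e -> enorm x = 1 -> enorm e <= eps ->
  enorm (F1 H x) <= 2 * Num.sqrt (c * eps / l).
Proof.
move=> Hspd c1 l0 Hx x1 e_eps.
have eps0 : 0 <= eps by exact: le_trans (enorm_ge0 e) e_eps.
have xx : dot x x = 1 by rewrite -enorm_sqr x1 expr1n.
have x0 : x != 0 by rewrite -dot_eq0 xx oner_eq0.
apply: enorm_le; first by rewrite mulr_ge0 ?sqrtr_ge0.
have ce0 : 0 <= c * eps / l.
  by apply: divr_ge0; [apply: mulr_ge0 => //; lra|exact: ltW].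
rewrite exprMn sqr_sqrtr// -natrX dot_F1// qform_sqr; last by case: Hspd.
rewrite qformE Hx !dot_lin xx (dotC e x).
have := @approx_eigenvector_bound c l (dot x e) (dot e e) eps c1 l0 eps0.
rewrite [X in _ -> X <= _](_ : _ = 1 - (l + dot x e) ^+ 2 /
    (l ^+ 2 + 2 * l * dot x e + dot e e)); last first.
  by congr (_ - _ ^+ 2 / _); ring.
apply.
  (* Cauchy-Schwarz for the unit vector [x]: the component of [e] orthogonal to [x] has nonnegative
     squared norm. *)
  have := dot_ge0 (e - dot x e *: x); rewrite !dot_lin xx (dotC e x); lra.
by rewrite -enorm_sqr ler_sqr ?nnegrE ?enorm_ge0.
Qed.

(** Convergence of matrices refers to the max norm, so Euclidean decay has to be transferred to
    it. *)
Lemma norm_le_enorm x : `|x| <= enorm x.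
Proof.
rewrite [leLHS]/Num.Def.normr/= mx_normrE.
apply: bigmax_le => [|[i j] _]; rewrite ?enorm_ge0//= ord1.
rewrite -sqrtr_sqr ler_wsqrtr// (bigD1 i)//= lerDl sumr_ge0// => k _.
exact: sqr_ge0.
Qed.

Lemma cvg_enorm_geometric (u : nat -> 'cV[R]_m) (q c : R) :
  0 <= q -> q < 1 -> (forall k, enorm (u k) <= q ^+ k * c) ->
  u @ \oo --> (0 : 'cV[R]_m).
Proof.
move=> q0 q1 uc; apply/norm_cvg0P.
apply: (@squeeze_cvgr _ _ _ _ (cst 0) (fun k => q ^+ k * c)) => /=.
- by apply: nearW => k; rewrite normr_ge0 (le_trans (norm_le_enorm _)).
- exact: cvg_cst.
- rewrite -(mul0r c); apply: cvgMr_tmp; apply: cvg_expr.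
  by rewrite ger0_norm.
Qed.

End InnerProduct.

(** * Orthogonal change of variables *)

Section Orthogonal.
Context {R : realType} {m : nat}.
Variables U L : 'M[R]_m.
Hypothesis HU : orthogonalmx U.
Implicit Types x y : 'cV[R]_m.

Lemma dot_orthogonal x y : dot (U^T *m x) (U^T *m y) = dot x y.
Proof.
by case: HU => _ UU; rewrite /dot trmx_mul trmxK -mulmxA (mulmxA U) UU mul1mx.
Qed.

Lemma enorm_orthogonal x : enorm (U^T *m x) = enorm x.
Proof. by rewrite !enormE dot_orthogonal. Qed.

Lemma qform_conj x : qform (U *m L *m U^T) x = qform L (U^T *m x).
Proof. by rewrite /qform trmx_mul trmxK !mulmxA. Qed.

Lemma conj_sqr : U *m L *m U^T *m (U *m L *m U^T) = U *m (L *m L) *m U^T.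
Proof. by case: HU => UU _; rewrite !mulmxA -(mulmxA _ U^T U) UU mulmx1. Qed.

End Orthogonal.

(** * Passage to eigencoordinates *)

Section SpectralFacts.
Context {R : realType} {n : nat}.
Variables (H U : 'M[R]_n.+1) (lam : 'rV[R]_n.+1).
Hypotheses (Hspd : symposdef H) (Hspec : spectral_decomposition H U lam).
Let Lam : 'M[R]_n.+1 := diag_mx lam.
Let kappa := cond_num lam.
Implicit Types (x y : 'cV[R]_n.+1) (i j : 'I_n.+1).

Let HU : orthogonalmx U. Proof. by case: Hspec. Qed.
Let HE : H = U *m Lam *m U^T. Proof. by case: Hspec. Qed.
Let lam_gt0 i : 0 < lam 0 i. Proof. by case: Hspec. Qed.
Let lam_le i j : (i <= j)%N -> lam 0 i <= lam 0 j.
Proof. by case: Hspec => _ _ _; exact. Qed.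

Lemma qform_diag x : qform H x = qform Lam (U^T *m x).
Proof. by rewrite HE qform_conj. Qed.

Lemma qform_sqr_diag x : qform (H *m H) x = qform (Lam *m Lam) (U^T *m x).
Proof. by rewrite HE conj_sqr// qform_conj. Qed.

(** The two quadratic forms agree, so the step lengths do, and [U^T *m H = Lam *m U^T] carries over
    the direction. *)
Lemma F1_diag x : F1 Lam (U^T *m x) = U^T *m F1 H x.
Proof.
rewrite !F1E mulmxBr -scalemxAr -qform_diag -qform_sqr_diag.
by case: HU => UU _; rewrite HE !mulmxA UU mul1mx.
Qed.

Lemma F1_orbit_diag x k : F1_orbit Lam (U^T *m x) k = U^T *m F1_orbit H x k.
Proof. by elim: k => //= k ->; rewrite F1_diag. Qed.

Lemma cond_num_ge1 : 1 <= kappa.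
Proof. by rewrite ler_pdivlMr// mul1r lam_le. Qed.

Lemma rho_ijE i j : rho_ij lam i j = (kappa_ij lam i j - 1) / (kappa_ij lam i j + 1).
Proof.
rewrite /rho_ij /kappa_ij; have := lam_gt0 i; have := lam_gt0 j.
by move=> ? ?; field; rewrite !lt0r_neq0// addr_gt0.
Qed.

(** * Worst-case contraction *)

Let rho : R := (kappa - 1) / (kappa + 1).

Lemma rho_ge0 : 0 <= rho.
Proof. by have := cond_num_ge1 => ?; rewrite divr_ge0//; lra. Qed.

Lemma rho_lt1 : rho < 1.
Proof. by have := cond_num_ge1 => ?; rewrite ltr_pdivrMr; lra. Qed.

Lemma enorm_F1_contract x : enorm (F1 H x) <= rho * enorm x.
Proof.
have rhoE : rho = rho_ij lam ord0 ord_max by rewrite rho_ijE.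
apply: enorm_le; first by rewrite mulr_ge0 ?rho_ge0 ?enorm_ge0.
set a := lam 0 ord0; set b := lam 0 ord_max.
have a0 : 0 < a := lam_gt0 _; have b0 : 0 < b := lam_gt0 _.
apply: le_trans (dot_F1_le x (2 / (a + b)) Hspd) _.
(* In the coordinates [y = U^T *m x] the comparison vector is diagonal, so the inequality can be
   checked coordinate by coordinate. *)
rewrite -(dot_orthogonal HU) exprMn enorm_sqr -(dot_orthogonal HU x).
rewrite mulmxBr -scalemxAr HE !mulmxA; case: HU => -> _; rewrite mul1mx -mulmxA.
move: (U^T *m x) => y; rewrite !dotE mulr_sumr; apply: ler_sum => i _.
rewrite mul_diag_mx !mxE -!expr2.
rewrite [X in X ^+ 2 <= _](_ : _ = (1 - 2 / (a + b) * lam 0 i) * y i 0);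
  last by ring.
rewrite exprMn ler_wpM2r ?sqr_ge0// rhoE /rho_ij -/a -/b.
have al : a <= lam 0 i by rewrite lam_le.
have lb : lam 0 i <= b by rewrite lam_le// leq_ord.
(* As [lam 0 i] lies in [[a, b]], the numerator lies in [[a - b, b - a]]. *)
rewrite (_ : 1 - _ = (a + b - 2 * lam 0 i) / (b + a)); last first.
  by field; rewrite lt0r_neq0// addr_gt0.
rewrite !expr_div_n ler_pM2r ?invr_gt0 ?exprn_gt0 ?addr_gt0//; nra.
Qed.

Lemma enorm_F1_orbit x k : enorm (F1_orbit H x k) <= rho ^+ k * enorm x.
Proof.
elim: k => [|k ih]; first by rewrite mul1r.
rewrite exprS -mulrA; apply: le_trans (enorm_F1_contract _) _.
by rewrite ler_wpM2l// rho_ge0.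
Qed.

Lemma dot_col i j : dot (col i U) (col j U) = (i == j)%:R.
Proof.
case: HU => UU _; have := congr1 (fun M : 'M[R]_n.+1 => M i j) UU.
by rewrite /= [in RHS]mxE => <-; rewrite /dot !mxE; apply: eq_bigr => k _; rewrite !mxE.
Qed.

Lemma mul_col i : H *m col i U = lam 0 i *: col i U.
Proof.
rewrite !colE mulmxA HE -(mulmxA _ U^T); case: HU => -> _.
by rewrite mulmx1 -!colE mul_mx_diag; apply/colP => k; rewrite !mxE mulrC.
Qed.

(** * Dynamics on the critical lines of one pair of indices *)

Section Pair.
Variables i j : 'I_n.+1.
Hypothesis lij : lam 0 i < lam 0 j.

Let neq_ij : i != j. Proof. by apply/eqP => ij; move: lij; rewrite ij ltxx. Qed.

Let s : R := lam 0 i + lam 0 j.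
Let s_gt0 : 0 < s. Proof. exact: addr_gt0. Qed.

Let ai : R := Num.sqrt (lam 0 j / s).
Let aj : R := Num.sqrt (lam 0 i / s).
Let ai2 : ai * ai = lam 0 j / s.
Proof. by rewrite -expr2 sqr_sqrtr// divr_ge0// ltW. Qed.
Let aj2 : aj * aj = lam 0 i / s.
Proof. by rewrite -expr2 sqr_sqrtr// divr_ge0// ltW. Qed.

Lemma rho_ij_gt0 : 0 < rho_ij lam i j.
Proof. by rewrite divr_gt0 ?subr_gt0// addr_gt0. Qed.

(** Taking [b] to be [aj] or [- aj] treats both lines at once, since the quadratic forms see only
    [b * b]. *)
Lemma F1_combination b : b * b = lam 0 i / s ->
  F1 H (ai *: col i U + b *: col j U) =
  rho_ij lam i j *: (ai *: col i U - b *: col j U).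
Proof.
move=> b2; set x := _ + _.
have Hx : H *m x = (ai * lam 0 i) *: col i U + (b * lam 0 j) *: col j U.
  by rewrite mulmxDr -!scalemxAr !mul_col !scalerA.
have HT : H^T = H by case: Hspd.
rewrite F1E qform_sqr// qformE Hx /x !dot_lin !dot_col !eqxx eq_sym (negbTE neq_ij).
have li := lam_gt0 i; have lj := lam_gt0 j.
have ne : [/\ lam 0 i != 0, lam 0 j != 0 & s != 0] by rewrite !lt0r_neq0.
(* Writing [li], [lj] for the two eigenvalues, the numerator is [2 * li * lj / s] and the
   denominator is [li * lj]. *)
rewrite [X in _ - X *: _](_ : _ = 2 / s); last first.
  rewrite !(mulr1, mulr0, addr0, add0r).
  rewrite [X in X / _ = _](_ : _ = (ai * ai) * lam 0 i + (b * b) * lam 0 j);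
    last by ring.
  rewrite [X in _ / X = _](_ : _ = (ai * ai) * lam 0 i ^+ 2
    + (b * b) * lam 0 j ^+ 2); last by ring.
  rewrite ai2 b2; case: ne => ? ? s0.
  rewrite [X in _ / X = _](_ : _ = lam 0 i * lam 0 j); last first.
    by rewrite /s; field; exact: s0.
  by field; apply/and3P.
(* It remains that [1 - 2 * li / s] is [rho_ij] and [1 - 2 * lj / s] is its opposite. *)
rewrite scalerDr !scalerBr !scalerA opprD addrACA -!scalerBl -scaleNr.
by case: ne => ? ? ?; congr (_ *: _ + _ *: _);
  rewrite /rho_ij /s; field; rewrite lt0r_neq0 ?addr_gt0.
Qed.

Lemma F1_rplus : F1 H (rplus U lam i j) = rho_ij lam i j *: rminus U lam i j.
Proof. exact: F1_combination. Qed.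

Lemma F1_rminus : F1 H (rminus U lam i j) = rho_ij lam i j *: rplus U lam i j.
Proof.
rewrite /rminus -scaleNr F1_combination ?mulrNN//.
by rewrite scaleNr opprK.
Qed.

Lemma enorm_rplus : enorm (rplus U lam i j) = 1.
Proof.
rewrite enormE /rplus !dot_lin !dot_col !eqxx eq_sym (negbTE neq_ij).
rewrite !(mulr1, mulr0, addr0, add0r) -/s -/ai -/aj ai2 aj2 -mulrDl addrC divff ?sqrtr1//.
exact: lt0r_neq0.
Qed.

Lemma enorm_rminus : enorm (rminus U lam i j) = 1.
Proof.
rewrite -enorm_rplus !enormE /rplus /rminus !dot_lin !dot_col !eqxx eq_sym (negbTE neq_ij).
by rewrite !(mulr1, mulr0, addr0, add0r, subr0, oppr0, sub0r, opprK).
Qed.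

Lemma F1_line :
  (forall x, lplus U lam i j x -> lminus U lam i j (F1 H x)) /\
  (forall x, lminus U lam i j x -> lplus U lam i j (F1 H x)).
Proof.
by split=> _ [a _ <-]; rewrite F1Z ?F1_rplus ?F1_rminus scalerA;
  exists (a * rho_ij lam i j).
Qed.

Lemma F1_orbit_line r0 k :
  (lplus U lam i j r0 ->
     if odd k then lminus U lam i j (F1_orbit H r0 k)
     else lplus U lam i j (F1_orbit H r0 k)) /\
  (lminus U lam i j r0 ->
     if odd k then lplus U lam i j (F1_orbit H r0 k)
     else lminus U lam i j (F1_orbit H r0 k)).
Proof.
have [Fp Fm] := F1_line.
by split=> h; elim: k => //= k; case: (odd k) => /=; auto.
Qed.

Lemma enorm_F1_line x : lplus U lam i j x \/ lminus U lam i j x ->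
  enorm (F1 H x) = rho_ij lam i j * enorm x.
Proof.
have r0 := ltW rho_ij_gt0.
by move=> [] [a _ <-]; rewrite F1Z ?F1_rplus ?F1_rminus !enormZ enorm_rplus
  enorm_rminus (ger0_norm r0) !mulr1 mulrC.
Qed.

Lemma enorm_F1_orbit_line r0 k : lplus U lam i j r0 \/ lminus U lam i j r0 ->
  enorm (F1_orbit H r0 k) = rho_ij lam i j ^+ k * enorm r0.
Proof.
move=> h; elim: k => [|k ih]; first by rewrite mul1r.
rewrite exprS -mulrA -ih; apply: enorm_F1_line.
have [Fp Fm] := F1_orbit_line r0 k.
by case: h => [/Fp|/Fm]; case: odd; auto.
Qed.

(* The convex combination cancels the component along [col j U]. *)
Lemma F1_convex_line x (t := rho_ij lam i j / (rho_ij lam i j + 1)) :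
  lplus U lam i j x \/ lminus U lam i j x ->
  F1 H (t *: x + (1 - t) *: F1 H x) = 0.
Proof.
move=> h; have r0 := rho_ij_gt0.
(* The weight [t] is chosen so that [rplus] and [rminus] receive the same coefficient [t * a]; their
   sum is [2 * ai] times [col i U], whence the witness below. *)
have tE : (1 - t) * rho_ij lam i j = t.
  by rewrite /t; field; rewrite lt0r_neq0// addr_gt0.
suff [c ->] : exists c, t *: x + (1 - t) *: F1 H x = c *: col i U.
  by apply: (F1_eigenvector (mu := lam 0 i) Hspd);
    rewrite -scalemxAr mul_col !scalerA mulrC.
case: h => -[a _ <-]; exists (t * a * 2 * ai).
  rewrite F1Z F1_rplus !scalerA [X in _ + X *: _](_ : _ = t * a) -?scalerDr; last first.
    by rewrite -[in RHS]tE; ring.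
  by rewrite addrACA subrr addr0 -mulr2n -scaler_nat !scalerA.
rewrite F1Z F1_rminus !scalerA [X in _ + X *: _](_ : _ = t * a) -?scalerDr; last first.
    by rewrite -[in RHS]tE; ring.
by rewrite addrACA addNr addr0 -mulr2n -scaler_nat !scalerA.
Qed.

End Pair.

(** The lines are covered by the image of the ordered pairs of distinct indices: an increasing pair
    codes a plus line, a decreasing one a minus line. *)
Lemma card_critical_lines : critical_lines U lam #<= `I_(n.+1 * n).
Proof.
pose f (p : 'I_n.+1 * 'I_n) : set 'cV[R]_n.+1 :=
  (* [lift p.1] enumerates the [n] indices other than [p.1]. *)
  let q := lift p.1 p.2 in
  if (p.1 < q)%N then lplus U lam p.1 q else lminus U lam q p.1.
rewrite (_ : (n.+1 * n)%N = #|{: 'I_n.+1 * 'I_n}|); last first.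
  by rewrite card_prod !card_ord.
rewrite (card_le_eqr card_II).
apply: (card_le_trans _ (card_image_le (f \o enum_val) [set: _])).
apply: subset_card_le => A [i [j [lij ijE]]].
(* The eigenvalues are sorted, so a strict inequality between them orders the indices. *)
have ij : (i < j)%N.
  by rewrite ltnNge; apply/negP => /lam_le; rewrite leNgt lij.
have ji : j != i by rewrite -val_eqE gtn_eqF.
case: ijE => ->.
  have /unlift_some[b bE _] : i != j by rewrite eq_sym.
  exists (enum_rank (i, b)); first by [].
  by rewrite /comp enum_rankK /f [lift _ _](_ : _ = j)// ij.
have /unlift_some[b bE _] := ji.
exists (enum_rank (j, b)); first by [].
by rewrite /comp enum_rankK /f [lift _ _](_ : _ = i)// ltnNge (ltnW ij).
Qed.

End SpectralFacts.

(* The dimension is m = n.+1. *)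
Theorem theorem3 (R : realType) (n : nat) (H U : 'M[R]_n.+1)
    (lam : 'rV[R]_n.+1)
    (Hspd : symposdef H)
    (Hspec : spectral_decomposition H U lam) :
  let Lam : 'M[R]_n.+1 := diag_mx lam in
  let kappa : R := cond_num lam in
  (* (i) *)
  [/\ [/\ forall (a : R) (r : 'cV[R]_n.+1), F1 H (a *: r) = a *: F1 H r,
          forall r0 : 'cV[R]_n.+1, r0 != 0 ->
            forall k : nat,
              F1_orbit H r0 k = enorm r0 *: F1_orbit H ((enorm r0)^-1 *: r0) k
        & forall rho : R, 0 < rho ->
            [/\ set_bij (eball 1) (eball rho)
                  (fun x : 'cV[R]_n.+1 => rho *: x),
                forall x : 'cV[R]_n.+1, eball rho x -> eball rho (F1 H x)
              & forall x : 'cV[R]_n.+1, eball 1 x ->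
                  forall k : nat, F1_orbit H (rho *: x) k = rho *: F1_orbit H x k]],
  (* (ii) *)
      forall r0 : 'cV[R]_n.+1,
        let y0 := U^T *m r0 in
        let r := F1_orbit H r0 in
        let y := F1_orbit Lam y0 in
        [/\ forall k : nat, enorm (r k) = enorm (y k),
            forall k : nat, r k != 0 ->
              [/\ enorm (r k.+1) ^+ 2 / enorm (r k) ^+ 2
                  = 1 - qform H (r k) ^+ 2 / qform (H *m H) (r k)
                        * (1 / enorm (r k) ^+ 2),
                  1 - qform H (r k) ^+ 2 / qform (H *m H) (r k)
                        * (1 / enorm (r k) ^+ 2)
                  = enorm (y k.+1) ^+ 2 / enorm (y k) ^+ 2
                & enorm (y k.+1) ^+ 2 / enorm (y k) ^+ 2
                  = 1 - qform Lam (y k) ^+ 2 / qform (Lam *m Lam) (y k)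
                        * (1 / enorm (y k) ^+ 2)]
          & [/\ r @ \oo --> (0 : 'cV[R]_n.+1),
                y @ \oo --> (0 : 'cV[R]_n.+1)
              & conv_rate r = conv_rate y]],
  (* (iii) *)
      (forall (r0 : 'cV[R]_n.+1) (mu : R),
          r0 != 0 -> H *m r0 = mu *: r0 ->
          F1 H r0 = 0 /\ forall k : nat, (1 <= k)%N -> F1_orbit H r0 k = 0)
      /\
      (forall (r0 e : 'cV[R]_n.+1) (lambda eps : R),
          0 < lambda ->
          H *m r0 = lambda *: r0 + e -> enorm r0 = 1 -> enorm e <= eps ->
          eps <= lambda ^+ 2 / (4 * kappa) ->
          enorm (F1 H r0) <= 2 * Num.sqrt (kappa * eps / lambda))
  (* (iv) *)
    & [/\ (2 <= n.+1)%N ->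
            critical_lines U lam #<= `I_(n.+1 * (n.+1 - 1)),
          forall i j : 'I_n.+1, lam 0 i < lam 0 j ->
            let rho := rho_ij lam i j in
            let kij := kappa_ij lam i j in
            let rp := rplus U lam i j in
            let rm := rminus U lam i j in
            let lp := lplus U lam i j in
            let lm := lminus U lam i j in
            let astar := rho / (rho + 1) in
            [/\ rho = (kij - 1) / (kij + 1),
                forall a : R, F1 H (a *: rp) = (a * rho) *: rm
                              /\ F1 H (a *: rm) = (a * rho) *: rp,
                forall r0 : 'cV[R]_n.+1,
                  (lp r0 -> forall k : nat,
                     if odd k then lm (F1_orbit H r0 k) else lp (F1_orbit H r0 k))
                  /\
                  (lm r0 -> forall k : nat,
                     if odd k then lp (F1_orbit H r0 k) else lm (F1_orbit H r0 k)),
                forall r0 : 'cV[R]_n.+1, lp r0 \/ lm r0 ->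
                  forall k : nat, enorm (F1_orbit H r0 k) = rho ^+ k * enorm r0
              & 0 <= astar <= 1 /\
                forall (r0 : 'cV[R]_n.+1) (k : nat),
                  let r := F1_orbit H r0 in
                  lp (r k) \/ lm (r k) ->
                  F1 H (astar *: r k + (1 - astar) *: r k.+1) = 0]
        & lam 0 ord0 < lam 0 ord_max ->
            (* (kappa - 1) / (kappa + 1) per step is the worst case ... *)
            (forall (s0 : 'cV[R]_n.+1) (k : nat),
               enorm (F1_orbit H s0 k)
               <= ((kappa - 1) / (kappa + 1)) ^+ k * enorm s0)
            /\
            (* ... and it is attained on the 1m-critical lines. *)
            (forall r0 : 'cV[R]_n.+1,
               lplus U lam ord0 ord_max r0 \/ lminus U lam ord0 ord_max r0 ->
               forall k : nat,
                 enorm (F1_orbit H r0 k)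
                 = rho_ij lam ord0 ord_max ^+ k * enorm r0
                 /\
                 rho_ij lam ord0 ord_max ^+ k * enorm r0
                 = ((kappa - 1) / (kappa + 1)) ^+ k * enorm r0)]].
Proof.
have [HU HE lam_gt0 lam_le] := Hspec.
have HUT r0 k : F1_orbit (diag_mx lam) (U^T *m r0) k = U^T *m F1_orbit H r0 k.
  exact: F1_orbit_diag Hspec r0 k.
have norm_rk r0 k : enorm (F1_orbit H r0 k) =
    enorm (F1_orbit (diag_mx lam) (U^T *m r0) k).
  by rewrite HUT enorm_orthogonal.
move=> Lam kappa; split.
- split=> [|r0 r00 k|rho rho0]; first exact: F1Z.
    by rewrite F1_orbitZ scalerA divff ?scale1r// enorm_eq0.
  split=> [|x|x _ k]; last exact: F1_orbitZ.
    exact: set_bij_eball.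
  by apply: le_trans; exact: enorm_F1_le.
- move=> r0 y0 r y.
  have rE k : r k != 0 -> enorm (r k.+1) ^+ 2 / enorm (r k) ^+ 2 =
      1 - qform H (r k) ^+ 2 / qform (H *m H) (r k) * (1 / enorm (r k) ^+ 2).
    exact: F1_ratio.
  have nE k : enorm (y k) = enorm (r k) by apply/esym/norm_rk.
  have qE k : qform Lam (y k) = qform H (r k).
    by rewrite /y HUT; exact/esym/qform_diag.
  have q2E k : qform (Lam *m Lam) (y k) = qform (H *m H) (r k).
    by rewrite /y HUT; exact/esym/qform_sqr_diag.
  have r_le k : enorm (r k) <= ((kappa - 1) / (kappa + 1)) ^+ k * enorm r0.
    exact: (enorm_F1_orbit Hspd Hspec).
  clearbody r y; split=> [k|k rk0|]; first by rewrite nE.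
    by rewrite qE q2E !nE -rE.
  split.
  + exact: cvg_enorm_geometric (rho_ge0 Hspec) (rho_lt1 Hspec) r_le.
  + apply: (cvg_enorm_geometric (c := enorm r0) (rho_ge0 Hspec) (rho_lt1 Hspec)).
    by move=> k; rewrite nE.
  (* The norms agree term by term, so both rates are the upper limit of one sequence. *)
  + by congr limn_esup; apply/funext => k; rewrite !nE.
- split=> [r0 mu r00 Hr0|r0 e l eps l0 Hr0 r01 e_eps _].
    have F0 := F1_eigenvector Hspd Hr0; split=> // -[//|k] _.
    (* From index 1 on, the orbit is that of [F1 H r0 = 0]. *)
    by rewrite /F1_orbit iterSr F0; exact: F1_orbit0.
  exact: enorm_F1_approx_eigenvector Hspd (cond_num_ge1 Hspec) l0 Hr0 r01 e_eps.
- split=> [_|i j lij rho kij rp rm lp lm astar|l1m].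
  + by rewrite subSS subn0; exact: card_critical_lines Hspec.
  + have r0 := rho_ij_gt0 Hspec lij.
    split.
    * exact: rho_ijE Hspec i j.
    * by move=> a; rewrite !F1Z (F1_rplus Hspd Hspec lij)
        (F1_rminus Hspd Hspec lij) !scalerA.
    * by move=> x; split=> h k; have [Fp Fm] := F1_orbit_line Hspd Hspec lij x k;
        [exact: Fp|exact: Fm].
    * by move=> x h k; exact: (enorm_F1_orbit_line Hspd Hspec).
    * split; last by move=> x k r; exact: (F1_convex_line Hspd Hspec).
      rewrite divr_ge0 ?addr_ge0 ?(ltW r0)//= ler_pdivrMr ?addr_gt0//.
      by rewrite mul1r lerDl.
  + split=> [s0 k|x h k]; first exact: (enorm_F1_orbit Hspd Hspec).
    rewrite -(rho_ijE Hspec) -(enorm_F1_orbit_line Hspd Hspec l1m) //.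
Qed.
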